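(* For every $M\in\Lambda^{001}$, $\mathrm{NF}_r(\mathcal T(M))=\mathcal T(\mathrm{BT}(M))$, where $\mathrm{NF}_r(\mathcal S)=\bigcup_{s\in\mathcal S}\mathrm{nf}_r(s)$.
   Context: $\Lambda_\bot^{001}$: possibly infinite trees built from variables, a constant $\bot$, abstractions and applications $(M)N$, whose infinite branches all enter infinitely often the argument position $N$ of an application, up to α-equivalence; $\Lambda^{001}$ consists of those without $\bot$. $\longrightarrow_\beta^*$ is the reflexive-transitive closure of one-step β-reduction; $\longrightarrow_\beta^\infty$ is defined by the rules (var) $M\longrightarrow_\beta^* x\Rightarrow M\longrightarrow_\beta^\infty x$, (λ) $M\longrightarrow_\beta^*\lambda x.P$, $P\longrightarrow_\beta^\infty P'\Rightarrow M\longrightarrow_\beta^\infty\lambda x.P'$, (@) $M\longrightarrow_\beta^*(P)Q$, $P\longrightarrow_\beta^\infty P'$, $Q\longrightarrow_\beta^\infty Q'\Rightarrow M\longrightarrow_\beta^\infty(P')Q'$, with possibly infinite derivations in which every infinite branch crosses infinitely often the third premise of (@). $M$ is solvable if $(\dots((\lambda x_1\dots\lambda x_m.M)N_1)\dots)N_n\longrightarrow_\beta^\infty\lambda x.x$ for some variables and terms, unsolvable otherwise. Head reduction $\longrightarrow_h$ contracts the redex $(\lambda z.N)P$ in $\lambda x_1\dots\lambda x_m.(\dots((\lambda z.N)P)Q_1\dots)Q_n$. The Böhm tree $\mathrm{BT}(M)\in\Lambda_\bot^{001}$ is defined corecursively: if $M$ is solvable and $M\longrightarrow_h^*\lambda x_1\dots\lambda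 x_m.(\dots((y)M_1)\dots)M_n$ then $\mathrm{BT}(M)=\lambda x_1\dots\lambda x_m.(\dots((y)\mathrm{BT}(M_1))\dots)\mathrm{BT}(M_n)$; otherwise $\mathrm{BT}(M)=\bot$. Resource terms: $s::=x\mid\lambda x.s\mid\langle s\rangle\bar t$, $\bar t$ a finite multiset; finite sums are finite sets of resource terms; resource reduction $\longmapsto_r$ is generated by $\langle\lambda x.s\rangle\bar t\longmapsto_r s\langle\bar t/x\rangle$ (for $\bar t=[t_1,\dots,t_n]$: sum over $\sigma\in\mathfrak S_n$ of the linear substitutions of $t_{\sigma(i)}$ for the $i$-th free occurrence of $x$ when $x$ has exactly $n$ free occurrences in $s$, and $0$ otherwise) and closed under all contexts; on finite sums, $\sum_{i=0}^n s_i\longrightarrow_r\sum_{i=0}^n T_i$ when $s_0\longmapsto_r T_0$ and each other $s_i$ either reduces to $T_i$ or equals it. This reduction is confluent and weakly normalising; $\mathrm{nf}_r(s)$ is the normal form (a finite set) of $s$. Taylor approximation $\ltimes$ is inductive: $x\ltimes x$; $s\ltimes M\Rightarrow\lambda x.s\ltimes\lambda x.M$; ($s\ltimes M$ and $t_i\ltimes N$ for all $i$) $\Rightarrow\langle s\rangle[t_1,\dots,t_n]\ltimes(M)N$; no resource term approximates $\bot$; $\mathcal T(M)=\{s : s\ltimes M\}$. *)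

(* Defs.v *)
From Stdlib Require Import List Arith Permutation Relations.
Import ListNotations.
Set Implicit Arguments.

CoInductive term : Type :=
| Var : nat -> term
| Bot : term
| Lam : term -> term
| App : term -> term -> term.

Fixpoint lams (m : nat) (M : term) : term :=
  match m with 0 => M | S k => Lam (lams k M) end.
Fixpoint apps (M : term) (Ns : list term) : term :=
  match Ns with [] => M | N :: Ns' => apps (App M N) Ns' end.

(* Lambda^001 (without bottom): finitely many steps along lambda bodies
   and function positions before entering an argument position, and
   coinductively so in every argument position (greatest fixed point). *)
Inductive in001_step (P : term -> Prop) : term -> Prop :=
| i001_var n : in001_step P (Var n)
| i001_lam M : in001_step P M -> in001_step P (Lam M)
| i001_app M N : in001_step P M -> P N -> in001_step P (App M N).

Definition in001 (M : term) : Prop :=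
  exists P : term -> Prop, (forall N, P N -> in001_step P N) /\ P M.

Definition upren (f : nat -> nat) (n : nat) : nat :=
  match n with 0 => 0 | S k => S (f k) end.

CoFixpoint ren (f : nat -> nat) (M : term) : term :=
  match M with
  | Var n => Var (f n)
  | Bot => Bot
  | Lam P => Lam (ren (upren f) P)
  | App P Q => App (ren f P) (ren f Q)
  end.

Definition up (s : nat -> term) (n : nat) : term :=
  match n with 0 => Var 0 | S k => ren S (s k) end.

CoFixpoint subst (s : nat -> term) (M : term) : term :=
  match M with
  | Var n => s n
  | Bot => Bot
  | Lam P => Lam (subst (up s) P)
  | App P Q => App (subst s P) (subst s Q)
  end.

Definition subst0 (P N : term) : term :=
  subst (fun n => match n with 0 => P | S k => Var k end) N.

Inductive bstep : term -> term -> Prop :=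
| b_beta N P : bstep (App (Lam N) P) (subst0 P N)
| b_lam M M' : bstep M M' -> bstep (Lam M) (Lam M')
| b_appl M M' N : bstep M M' -> bstep (App M N) (App M' N)
| b_appr M N N' : bstep N N' -> bstep (App M N) (App M N').

Definition bstar : term -> term -> Prop := clos_refl_trans term bstep.

(* Infinitary beta reduction: rules (var), (lambda), (@), where every
   infinite branch must cross the third premise of (@) infinitely often:
   inductive in the first two kinds of premises, coinductive (greatest
   fixed point) in the third premise of (@). *)
Inductive binf_step (R : term -> term -> Prop) : term -> term -> Prop :=
| bi_var M x : bstar M (Var x) -> binf_step R M (Var x)
| bi_lam M P P' : bstar M (Lam P) -> binf_step R P P' -> binf_step R M (Lam P')
| bi_app M P Q P' Q' :
    bstar M (App P Q) -> binf_step R P P' -> R Q Q' -> binf_step R M (App P' Q').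

Definition binf (M N : term) : Prop :=
  exists R : term -> term -> Prop,
    (forall M0 N0, R M0 N0 -> binf_step R M0 N0) /\ R M N.

Definition solvable (M : term) : Prop :=
  exists (m : nat) (Ns : list term),
    Forall in001 Ns /\ binf (apps (lams m M) Ns) (Lam (Var 0)).

Inductive hstep : term -> term -> Prop :=
| h_redex N P Qs : hstep (apps (App (Lam N) P) Qs) (apps (subst0 P N) Qs)
| h_lam M M' : hstep M M' -> hstep (Lam M) (Lam M').

Definition hstar : term -> term -> Prop := clos_refl_trans term hstep.

(* Boehm tree, as the (greatest-fixed-point) relation BT M B meaning
   B = BT(M). *)
Inductive BT_step (R : term -> term -> Prop) : term -> term -> Prop :=
| BTs_bot M :
    ~ (solvable M /\ exists m y Ms, hstar M (lams m (apps (Var y) Ms))) ->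
    BT_step R M Bot
| BTs_hnf M m y Ms Bs :
    solvable M -> hstar M (lams m (apps (Var y) Ms)) -> Forall2 R Ms Bs ->
    BT_step R M (lams m (apps (Var y) Bs)).

Definition BT (M B : term) : Prop :=
  exists R : term -> term -> Prop,
    (forall M0 B0, R M0 B0 -> BT_step R M0 B0) /\ R M B.

(* Resource terms (de Bruijn); bags are lists considered up to
   permutation (see req).                                               *)
Inductive rterm : Type :=
| RVar : nat -> rterm
| RLam : rterm -> rterm
| RApp : rterm -> list rterm -> rterm.

Inductive req : rterm -> rterm -> Prop :=
| req_var n : req (RVar n) (RVar n)
| req_lam s s' : req s s' -> req (RLam s) (RLam s')
| req_app s s' us us' vs :
    req s s' -> Permutation us' vs -> Forall2 req us vs ->
    req (RApp s us) (RApp s' us').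

Fixpoint rlift (c d : nat) (t : rterm) : rterm :=
  match t with
  | RVar n => RVar (if c <=? n then n + d else n)
  | RLam s => RLam (rlift (S c) d s)
  | RApp s us => RApp (rlift c d s) (map (rlift c d) us)
  end.

Fixpoint occ (k : nat) (t : rterm) : nat :=
  match t with
  | RVar n => if n =? k then 1 else 0
  | RLam s => occ (S k) s
  | RApp s us => occ k s + list_sum (map (occ k) us)
  end.

(* lsub k ts s : replaces the successive free occurrences of variable k
   in s (left-to-right) by the successive elements of ts (suitably
   lifted); the binder of k is removed, so free variables above k are
   decremented. Returns the unused elements of ts. *)
Fixpoint lsub (k : nat) (ts : list rterm) (s : rterm) : rterm * list rterm :=
  match s with
  | RVar n =>
      if n =? k then
        match ts with
        | [] => (RVar n, [])
        | t :: ts' => (rlift 0 k t, ts')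
        end
      else (RVar (if k <? n then n - 1 else n), ts)
  | RLam s0 => let (s', ts') := lsub (S k) ts s0 in (RLam s', ts')
  | RApp s0 us =>
      let (s', ts1) := lsub k ts s0 in
      let (us', ts2) :=
        (fix go (ts : list rterm) (us : list rterm) : list rterm * list rterm :=
           match us with
           | [] => ([], ts)
           | u :: us0 =>
               let (u', ts1) := lsub k ts u in
               let (r, ts2) := go ts1 us0 in (u' :: r, ts2)
           end) ts1 us in
      (RApp s' us', ts2)
  end.

Fixpoint insert_all {A : Type} (a : A) (l : list A) : list (list A) :=
  match l with
  | [] => [[a]]
  | b :: l' => (a :: b :: l') :: map (cons b) (insert_all a l')
  end.

Fixpoint perms {A : Type} (l : list A) : list (list A) :=
  match l with
  | [] => [[]]
  | a :: l' => flat_map (insert_all a) (perms l')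
  end.

(* s<ts/x> : a finite sum, represented as a list (read as a set);
   the empty list is the sum 0. *)
Definition rsubst0 (s : rterm) (ts : list rterm) : list rterm :=
  if occ 0 s =? length ts then map (fun ts' => fst (lsub 0 ts' s)) (perms ts)
  else [].

Inductive rstep : rterm -> list rterm -> Prop :=
| r_beta s ts : rstep (RApp (RLam s) ts) (rsubst0 s ts)
| r_lam s T : rstep s T -> rstep (RLam s) (map RLam T)
| r_appl s T us : rstep s T -> rstep (RApp s us) (map (fun t => RApp t us) T)
| r_appr s us1 u us2 T :
    rstep u T ->
    rstep (RApp s (us1 ++ u :: us2)) (map (fun t => RApp s (us1 ++ t :: us2)) T).

Definition sum_step (S S' : list rterm) : Prop :=
  exists Ts : list (list rterm),
    Forall2 (fun s T => rstep s T \/ T = [s]) S Ts /\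
    (exists i s T, nth_error S i = Some s /\ nth_error Ts i = Some T /\ rstep s T) /\
    S' = concat Ts.

Definition sum_red_star : list rterm -> list rterm -> Prop :=
  clos_refl_trans (list rterm) sum_step.

Definition sum_normal (T : list rterm) : Prop :=
  forall t, In t T -> ~ exists T', rstep t T'.

Definition nf_r (s : rterm) (T : list rterm) : Prop :=
  sum_red_star [s] T /\ sum_normal T.

Definition in_sum (t : rterm) (T : list rterm) : Prop :=
  exists t', In t' T /\ req t t'.

Definition NF_r (S : rterm -> Prop) (t : rterm) : Prop :=
  exists s, S s /\ exists T, nf_r s T /\ in_sum t T.

Inductive ltimes : rterm -> term -> Prop :=
| tl_var n : ltimes (RVar n) (Var n)
| tl_lam s M : ltimes s M -> ltimes (RLam s) (Lam M)
| tl_app s ts M N :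
    ltimes s M -> Forall (fun t => ltimes t N) ts -> ltimes (RApp s ts) (App M N).

Definition Taylor (M : term) : rterm -> Prop := fun s => ltimes s M.

(* Main.v *)
Require Import Defs.
From Stdlib Require Import List Arith Permutation Relations Lia.
From Stdlib Require Import Classical ClassicalEpsilon.
Import ListNotations.

(* No confluence argument is needed. Close Taylor approximation under weak head
   expansion at every node: the resulting relation [approx s M] is inductive in s and
   is preserved when s is replaced by any element of a one-step reduct of s, since
   weak head reduction is stable under substitution. So every t in nf_r(s), with s in
   T(M), is a normal term with [approx t M]; the weak head reductions along the spine
   of t compose into a head reduction of M to a head normal form whose arguments are
   approximated by the bags of t, and induction on the size of t gives t in T(BT(M)).
   Conversely, an approximant of M' with M ->h M' is an element of a one-step reduct of
   an approximant of M; this yields for each t in T(BT(M)) some s in T(M) having t as an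
   element of one of its iterated reducts, and since reduction decreases size the rest
   of the sum can be normalised. Finally a term with a head normal form is solvable by
   applying it to sufficiently many copies of an eraser. *)

(** * Bisimilarity and substitution *)

(* Leibniz equality is too fine for the substitution lemmas on coinductive terms. *)
CoInductive bisim : term -> term -> Prop :=
| bisim_var n : bisim (Var n) (Var n)
| bisim_bot : bisim Bot Bot
| bisim_lam M N : bisim M N -> bisim (Lam M) (Lam N)
| bisim_app M N P Q : bisim M N -> bisim P Q -> bisim (App M P) (App N Q).

Lemma bisim_refl : forall M, bisim M M.
Proof. cofix CH; intros []; constructor; apply CH. Qed.

Lemma bisim_sym : forall M N, bisim M N -> bisim N M.
Proof. cofix CH; intros M N H; destruct H; constructor; apply CH; assumption. Qed.

Lemma bisim_trans : forall M N P, bisim M N -> bisim N P -> bisim M P.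
Proof.
  cofix CH; intros M N P H1 H2; destruct H1; inversion H2; subst; constructor;
    eapply CH; eassumption.
Qed.

Lemma term_eta M :
  M = match M with
      | Var n => Var n | Bot => Bot | Lam P => Lam P | App P Q => App P Q
      end.
Proof. destruct M; reflexivity. Qed.

Lemma ren_var f n : ren f (Var n) = Var (f n).
Proof. rewrite (term_eta (ren _ _)); reflexivity. Qed.
Lemma ren_bot f : ren f Bot = Bot.
Proof. rewrite (term_eta (ren _ _)); reflexivity. Qed.
Lemma ren_lam f M : ren f (Lam M) = Lam (ren (upren f) M).
Proof. rewrite (term_eta (ren _ _)); reflexivity. Qed.
Lemma ren_app f M N : ren f (App M N) = App (ren f M) (ren f N).
Proof. rewrite (term_eta (ren _ _)); reflexivity. Qed.

Lemma subst_var s n : subst s (Var n) = s n.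
Proof. rewrite (term_eta (subst _ _)); simpl; symmetry; apply term_eta. Qed.
Lemma subst_bot s : subst s Bot = Bot.
Proof. rewrite (term_eta (subst _ _)); reflexivity. Qed.
Lemma subst_lam s M : subst s (Lam M) = Lam (subst (up s) M).
Proof. rewrite (term_eta (subst _ _)); reflexivity. Qed.
Lemma subst_app s M N : subst s (App M N) = App (subst s M) (subst s N).
Proof. rewrite (term_eta (subst _ _)); reflexivity. Qed.

(** A composite such as [subst s (ren f M)] shows a constructor to the outer operation only once the
    inner one has been pushed, hence the second round for [subst]. *)
Ltac push :=
  rewrite ?subst_var, ?subst_bot, ?subst_lam, ?subst_app,
          ?ren_var, ?ren_bot, ?ren_lam, ?ren_app,
          ?subst_var, ?subst_bot, ?subst_lam, ?subst_app.

Lemma ren_bisim : forall f g M N,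
  (forall n, f n = g n) -> bisim M N -> bisim (ren f M) (ren g N).
Proof.
  cofix CH; intros f g M N E H; destruct H; push.
  - rewrite E; constructor.
  - constructor.
  - constructor; apply CH; [intros []; simpl; congruence | assumption].
  - constructor; apply CH; assumption.
Qed.

Lemma subst_bisim : forall s t M N,
  (forall n, bisim (s n) (t n)) -> bisim M N -> bisim (subst s M) (subst t N).
Proof.
  cofix CH; intros s t M N E H; destruct H; push.
  - apply E.
  - constructor.
  - constructor; apply CH; [| assumption].
    intros []; simpl; [constructor | apply ren_bisim; auto].
  - constructor; apply CH; assumption.
Qed.

(** In this and the next three composition laws the composite is a parameter specified pointwise.
    Under a binder the corecursive call then absorbs the new presentation of the lifted composite;
    wrapping the call in transitivity would break guardedness. *)
Lemma ren_ren : forall f g h M,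
  (forall n, g (f n) = h n) -> bisim (ren g (ren f M)) (ren h M).
Proof.
  cofix CH; intros f g h M E; destruct M; push.
  - rewrite E; constructor.
  - constructor.
  - constructor; apply CH; intros []; simpl; congruence.
  - constructor; apply CH; assumption.
Qed.

Lemma subst_ren : forall f s t M,
  (forall n, bisim (s (f n)) (t n)) -> bisim (subst s (ren f M)) (subst t M).
Proof.
  cofix CH; intros f s t M E; destruct M; push.
  - apply E.
  - constructor.
  - constructor; apply CH; intros []; simpl; [constructor | apply ren_bisim; auto].
  - constructor; apply CH; assumption.
Qed.

Lemma ren_subst : forall f s t M,
  (forall n, bisim (ren f (s n)) (t n)) -> bisim (ren f (subst s M)) (subst t M).
Proof.
  cofix CH; intros f s t M E; destruct M; push.
  - apply E.
  - constructor.
  - constructor; apply CH; intros [|n]; simpl; push; [constructor |].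
    eapply bisim_trans; [apply ren_ren; reflexivity |].
    eapply bisim_trans; [| apply ren_bisim; [reflexivity | apply E]].
    apply bisim_sym, ren_ren; reflexivity.
  - constructor; apply CH; assumption.
Qed.

Lemma subst_subst : forall s t r M,
  (forall n, bisim (subst t (s n)) (r n)) -> bisim (subst t (subst s M)) (subst r M).
Proof.
  cofix CH; intros s t r M E; destruct M; push.
  - apply E.
  - constructor.
  - constructor; apply CH; intros [|n]; simpl; push; [constructor |].
    eapply bisim_trans; [apply subst_ren; intro; apply bisim_refl |].
    eapply bisim_trans; [| apply ren_bisim; [reflexivity | apply E]].
    apply bisim_sym, ren_subst; intro; apply bisim_refl.
  - constructor; apply CH; assumption.
Qed.

Lemma subst_id : forall s M, (forall n, bisim (s n) (Var n)) -> bisim (subst s M) M.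
Proof.
  cofix CH; intros s M E; destruct M; push.
  - apply E.
  - constructor.
  - constructor; apply CH; intros [|n]; simpl; [constructor |].
    rewrite <- (ren_var S); apply ren_bisim; auto.
  - constructor; apply CH; assumption.
Qed.

Lemma ren_as_subst : forall f s M,
  (forall n, s n = Var (f n)) -> bisim (ren f M) (subst s M).
Proof.
  cofix CH; intros f s M E; destruct M; push.
  - rewrite E; constructor.
  - constructor.
  - constructor; apply CH; intros [|n]; simpl; [reflexivity | rewrite E; apply ren_var].
  - constructor; apply CH; assumption.
Qed.

Definition scons (P : term) (n : nat) : term :=
  match n with 0 => P | S k => Var k end.

Lemma subst_subst0 s P N :
  bisim (subst s (subst0 P N)) (subst0 (subst s P) (subst (up s) N)).
Proof.
  unfold subst0.
  eapply bisim_trans; [apply subst_subst; intro; apply bisim_refl |].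
  apply bisim_sym, subst_subst; intros [|n]; simpl; push; [apply bisim_refl |].
  eapply bisim_trans; [apply subst_ren; intro; apply bisim_refl |].
  apply subst_id; intro; apply bisim_refl.
Qed.

Lemma subst0_bisim P Q M N :
  bisim P Q -> bisim M N -> bisim (subst0 P M) (subst0 Q N).
Proof.
  intros HP HM; apply subst_bisim; [| assumption].
  intros []; [assumption | constructor].
Qed.

(** * Weak head reduction *)

(** Weak head reduction suits a node-by-node relation: it serves to expose the root constructor, and
    reduction under λ is recovered at the abstraction nodes of [approx]. *)
Inductive wstep : term -> term -> Prop :=
| w_beta N P : wstep (App (Lam N) P) (subst0 P N)
| w_app M M' N : wstep M M' -> wstep (App M N) (App M' N).

Notation wstar := (clos_refl_trans_1n term wstep).

Lemma wstar_trans M N P : wstar M N -> wstar N P -> wstar M P.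
Proof. induction 1; [auto | econstructor; eauto]. Qed.

Lemma wstar_app M M' N : wstar M M' -> wstar (App M N) (App M' N).
Proof. induction 1; econstructor; [constructor |]; eauto. Qed.

Lemma wstep_bisim M M' N :
  wstep M M' -> bisim M N -> exists N', wstep N N' /\ bisim M' N'.
Proof.
  intro H; revert N; induction H; intros N0 B; inversion B; subst.
  - match goal with H : bisim (Lam _) _ |- _ => inversion H; subst end.
    eexists; split; [constructor | apply subst0_bisim; assumption].
  - edestruct IHwstep as (Z & ? & ?); [eassumption |].
    eexists; split; [constructor; eassumption | constructor; assumption].
Qed.

Lemma wstar_bisim M M' N :
  wstar M M' -> bisim M N -> exists N', wstar N N' /\ bisim M' N'.
Proof.
  intro H; revert N; induction H as [| M M1 M' H _ IH]; intros N B.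
  - exists N; split; [constructor | assumption].
  - destruct (wstep_bisim _ _ _ H B) as (N1 & ? & B1).
    destruct (IH _ B1) as (N' & ? & ?).
    exists N'; split; [econstructor; eassumption | assumption].
Qed.

Lemma wstep_subst s M M' :
  wstep M M' -> exists N, wstep (subst s M) N /\ bisim (subst s M') N.
Proof.
  induction 1 as [N P | M M' N H (N' & ? & ?)]; push.
  - eexists; split; [constructor | apply subst_subst0].
  - eexists; split; [constructor; eassumption |].
    push; constructor; [assumption | apply bisim_refl].
Qed.

(** [subst_subst0] holds up to bisimilarity, so after each step the rest of the reduction is
    transported along the discrepancy. *)
Lemma wstar_subst s M M' :
  wstar M M' -> exists N, wstar (subst s M) N /\ bisim (subst s M') N.
Proof.
  induction 1 as [| M M1 M' H _ (N & HN & BN)].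
  - eexists; split; [constructor | apply bisim_refl].
  - destruct (wstep_subst s _ _ H) as (N1 & ? & B1).
    destruct (wstar_bisim _ _ _ HN B1) as (N' & ? & ?).
    exists N'; split; [econstructor; eassumption | eapply bisim_trans; eassumption].
Qed.

(** * Approximation up to weak head reduction *)

(* Bag elements may approximate different reducts of the argument: this is what
   makes [approx] stable under reducing a single element of a bag. *)
Inductive approx : rterm -> term -> Prop :=
| approx_var n M : wstar M (Var n) -> approx (RVar n) M
| approx_lam s M P : wstar M (Lam P) -> approx s P -> approx (RLam s) M
| approx_app s ts M P Q :
    wstar M (App P Q) -> approx s P -> (forall t, In t ts -> approx t Q) ->
    approx (RApp s ts) M.

(** The generated principle gives no induction hypothesis on the elements of bags. *)
Lemma rterm_ind_bag (P : rterm -> Prop) :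
  (forall n, P (RVar n)) ->
  (forall s, P s -> P (RLam s)) ->
  (forall s ts, P s -> (forall t, In t ts -> P t) -> P (RApp s ts)) ->
  forall s, P s.
Proof.
  intros Hv Hl Ha; fix IH 1; intros [n | s | s ts].
  - apply Hv.
  - apply Hl, IH.
  - apply Ha; [apply IH |].
    induction ts as [| u us IHus]; [contradiction |]; intros t [Ht | Ht].
    + rewrite <- Ht; apply IH.
    + exact (IHus t Ht).
Qed.

Lemma approx_wstar s M M' : wstar M M' -> approx s M' -> approx s M.
Proof. intros H A; inversion A; subst; econstructor; eauto using wstar_trans. Qed.

Lemma approx_bisim s M N : bisim M N -> approx s M -> approx s N.
Proof.
  intros B A; revert N B.
  induction A as [n M H | s M P H A IH | s ts M P Q H A IH A' IH']; intros N B;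
    destruct (wstar_bisim _ _ _ H B) as (N' & H' & B'); inversion B'; subst;
    econstructor; eauto.
Qed.

Lemma approx_subst_wstar r s M M' :
  wstar M M' -> approx r (subst s M') -> approx r (subst s M).
Proof.
  intros H A; destruct (wstar_subst s _ _ H) as (N & ? & B).
  eapply approx_wstar; [eassumption | eapply approx_bisim; eassumption].
Qed.

Lemma approx_ltimes s M : ltimes s M -> approx s M.
Proof.
  revert M; induction s using rterm_ind_bag; intros M L; inversion L; subst;
    econstructor; try apply rt1n_refl; auto.
  intros t Ht; rewrite Forall_forall in *; auto.
Qed.

(** * Lifting and linear substitution of approximants *)

Fixpoint upn (k : nat) (s : nat -> term) : nat -> term :=
  match k with 0 => s | S k => up (upn k s) end.

Lemma upn_shift k n :
  upn k (fun n => Var (S n)) n = Var (if k <=? n then n + 1 else n).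
Proof.
  revert n; induction k as [| k IH]; intros n; [simpl; f_equal; lia |].
  destruct n as [| n]; [reflexivity |].
  simpl; rewrite IH, ren_var; destruct (k <=? n); f_equal; lia.
Qed.

(** Shifting is phrased as a substitution so that [approx_subst_wstar] serves here as well;
    [upn_shift] matches the variable clause of [rlift]. *)
Lemma approx_rlift s c M :
  approx s M -> approx (rlift c 1 s) (subst (upn c (fun n => Var (S n))) M).
Proof.
  intro A; revert c; induction A as [n M H | s M P H A IH | s ts M P Q H A IH A' IH'];
    intro c; eapply approx_subst_wstar; try eassumption; push; simpl.
  - rewrite upn_shift; constructor; constructor.
  - econstructor; [constructor | apply (IH (S c))].
  - econstructor; [constructor | apply IH |].
    intros t Ht; apply in_map_iff in Ht as (u & <- & Hu); auto.
Qed.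

Lemma approx_ren s M : approx s M -> approx (rlift 0 1 s) (ren S M).
Proof.
  intro A; eapply approx_bisim; [| apply (approx_rlift _ 0), A].
  apply bisim_sym, ren_as_subst; reflexivity.
Qed.

Lemma rlift_rlift c a b s : rlift c a (rlift c b s) = rlift c (a + b) s.
Proof.
  revert c; induction s using rterm_ind_bag; intro c; simpl.
  - destruct (Nat.leb_spec c n); [destruct (Nat.leb_spec c (n + b)) |
      destruct (Nat.leb_spec c n)]; f_equal; lia.
  - f_equal; auto.
  - f_equal; [auto |]; rewrite map_map; apply map_ext_in; auto.
Qed.

Lemma rlift_0 c s : rlift c 0 s = s.
Proof.
  revert c; induction s using rterm_ind_bag; intro c; simpl.
  - destruct (c <=? n); f_equal; lia.
  - f_equal; auto.
  - f_equal; [auto |]; rewrite <- map_id; apply map_ext_in; auto.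
Qed.

Lemma approx_rens k s M : approx s M -> approx (rlift 0 k s) (Nat.iter k (ren S) M).
Proof.
  intro A; induction k as [| k IH]; simpl.
  - rewrite rlift_0; assumption.
  - rewrite <- (rlift_rlift 0 1 k); apply approx_ren, IH.
Qed.

(** The right-hand side mirrors the variable clause of [lsub], with the lifting by [k] split into
    [k] single shifts. *)
Lemma upn_scons P k n :
  upn k (scons P) n =
  if n =? k then Nat.iter k (ren S) P else Var (if k <? n then n - 1 else n).
Proof.
  revert n; induction k as [| k IH]; intros [| n]; try reflexivity.
  - simpl; f_equal; lia.
  - simpl; rewrite IH; change (S k <? S n) with (k <? n).
    destruct (Nat.eqb_spec n k); [reflexivity |]; rewrite ren_var.
    destruct (Nat.ltb_spec k n); f_equal; lia.
Qed.

Lemma subst0_upn P N : subst0 P N = subst (upn 0 (scons P)) N.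
Proof. reflexivity. Qed.

(** The anonymous loop over bags inside [lsub], repeated verbatim so that [lsub_app] holds by
    conversion. *)
Definition lsubs (k : nat) : list rterm -> list rterm -> list rterm * list rterm :=
  fix go (ts : list rterm) (us : list rterm) : list rterm * list rterm :=
    match us with
    | [] => ([], ts)
    | u :: us0 =>
        let (u', ts1) := lsub k ts u in
        let (r, ts2) := go ts1 us0 in (u' :: r, ts2)
    end.

Lemma lsub_app k ts s us :
  lsub k ts (RApp s us) =
  let (s', ts1) := lsub k ts s in
  let (us', ts2) := lsubs k ts1 us in (RApp s' us', ts2).
Proof. reflexivity. Qed.

Lemma lsubs_cons k ts u us :
  lsubs k ts (u :: us) =
  let (u', ts1) := lsub k ts u in
  let (r, ts2) := lsubs k ts1 us in (u' :: r, ts2).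
Proof. reflexivity. Qed.

(** All elements of [ts] approximate the same [P], so it does not matter which occurrence receives
    which. The leftover list is computed exactly because it supplies the next subterm of the
    traversal; the bound on [occ k s] keeps [lsub] from reaching its default for an exhausted
    list. *)
Lemma lsub_approx P s N :
  approx s N -> forall k ts,
  (forall t, In t ts -> approx t P) -> occ k s <= length ts ->
  approx (fst (lsub k ts s)) (subst (upn k (scons P)) N) /\
  snd (lsub k ts s) = skipn (occ k s) ts.
Proof.
  induction 1 as [n M H | s M N H A IH | s us M N Q H A IH A' IH'];
    intros k ts Hts Hocc.
  - assert (approx (fst (lsub k ts (RVar n))) (upn k (scons P) n) /\
            snd (lsub k ts (RVar n)) = skipn (occ k (RVar n)) ts) as [HA HS].
    { rewrite upn_scons; simpl in *; destruct (n =? k).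
      - destruct ts as [| t ts]; simpl in *; [lia |].
        split; [apply approx_rens; auto | reflexivity].
      - split; [constructor; constructor | reflexivity]. }
    split; [| exact HS].
    eapply approx_subst_wstar; [eassumption | push; exact HA].
  - simpl in *; destruct (IH (S k) ts Hts Hocc) as [HA HS].
    destruct (lsub (S k) ts s) as [s' ts']; simpl in *; split; [| assumption].
    eapply approx_subst_wstar; [eassumption |]; push.
    econstructor; [constructor | exact HA].
  - rewrite lsub_app; simpl occ in *.
    destruct (IH k ts Hts) as [HA HS]; [lia |].
    destruct (lsub k ts s) as [s' ts1]; simpl in HA, HS; subst ts1.
    assert (Hus : forall ts, (forall t, In t ts -> approx t P) ->
              list_sum (map (occ k) us) <= length ts ->
              (forall t, In t (fst (lsubs k ts us)) ->
                 approx t (subst (upn k (scons P)) Q)) /\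
              snd (lsubs k ts us) = skipn (list_sum (map (occ k) us)) ts).
    { clear - IH'; induction us as [| u us IHus]; intros ts Hts Hocc.
      - split; [contradiction | reflexivity].
      - rewrite lsubs_cons; simpl map in *; simpl list_sum in *.
        destruct (IH' u (or_introl eq_refl) k ts Hts) as [HA HS]; [lia |].
        destruct (lsub k ts u) as [u' ts1]; simpl in HA, HS; subst ts1.
        destruct (IHus (fun t Ht => IH' t (or_intror Ht)) (skipn (occ k u) ts))
          as [HB HT].
        + intros t Ht; apply Hts; rewrite <- (firstn_skipn (occ k u) ts).
          apply in_or_app; auto.
        + rewrite length_skipn; lia.
        + destruct (lsubs k (skipn (occ k u) ts) us) as [us' ts2]; simpl in *; subst.
          split; [intros t [<- | Ht]; auto |].
          rewrite skipn_skipn; f_equal; lia. }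
    destruct (Hus (skipn (occ k s) ts)) as [HB HT].
    + intros t Ht; apply Hts; rewrite <- (firstn_skipn (occ k s) ts).
      apply in_or_app; auto.
    + rewrite length_skipn; lia.
    + destruct (lsubs k (skipn (occ k s) ts) us) as [us' ts2]; simpl in *; subst.
      split; [| rewrite skipn_skipn; f_equal; lia].
      eapply approx_subst_wstar; [eassumption |]; push.
      econstructor; [constructor | exact HA | exact HB].
Qed.

(** * Permutations of a bag *)

Lemma insert_all_perm {A} (a : A) l l' :
  In l' (insert_all a l) -> Permutation (a :: l) l'.
Proof.
  revert l'; induction l as [| b l IH]; simpl; intros l' H.
  - destruct H as [<- | []]; reflexivity.
  - destruct H as [<- | H]; [reflexivity |].
    apply in_map_iff in H as (l1 & <- & H).
    rewrite perm_swap; constructor; auto.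
Qed.

Lemma perms_perm {A} (l l' : list A) : In l' (perms l) -> Permutation l l'.
Proof.
  revert l'; induction l as [| a l IH]; simpl; intros l' H.
  - destruct H as [<- | []]; reflexivity.
  - apply in_flat_map in H as (l1 & H1 & H2).
    rewrite (IH _ H1); apply insert_all_perm, H2.
Qed.

Lemma perms_self {A} (l : list A) : In l (perms l).
Proof.
  induction l as [| a l IH]; simpl; [auto |].
  apply in_flat_map; exists l; split; [assumption | destruct l; simpl; auto].
Qed.

Lemma in_rsubst0 s ts s' :
  In s' (rsubst0 s ts) ->
  exists ts', Permutation ts ts' /\ occ 0 s = length ts' /\ s' = fst (lsub 0 ts' s).
Proof.
  unfold rsubst0; destruct (Nat.eqb_spec (occ 0 s) (length ts)) as [E |]; [| contradiction].
  intro H; apply in_map_iff in H as (ts' & <- & H); apply perms_perm in H.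
  exists ts'; rewrite <- (Permutation_length H); auto.
Qed.

(** Follows a single summand, which turns the reduction of sums into an ordinary relation on
    resource terms. *)
Definition pstep (s s' : rterm) : Prop := exists T, rstep s T /\ In s' T.
Notation pstar := (clos_refl_trans_1n rterm pstep).

(** In the β case the reductions witnessing the application and abstraction nodes compose with the
    contraction of the redex, so [M] itself weak head reduces to the substituted body. In the bag
    case one element changes while the others keep their own reductions of the argument. *)
Lemma approx_rstep s T : rstep s T -> forall M s', approx s M -> In s' T -> approx s' M.
Proof.
  induction 1 as [s ts | s T H IH | s T us H IH | s us1 u us2 T H IH];
    intros M s' A I; inversion A as [| ? ? P HM A1 | ? ? ? P Q HM A1 A2]; subst.
  - inversion A1 as [| ? ? P' HP A3 |]; subst.
    apply in_rsubst0 in I as (ts' & Hp & Hl & ->).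
    eapply approx_wstar.
    + eapply wstar_trans; [eassumption |].
      eapply wstar_trans; [apply wstar_app; eassumption |].
      econstructor; [apply w_beta | apply rt1n_refl].
    + rewrite subst0_upn; apply lsub_approx; [assumption | | lia].
      intros t Ht; apply A2; eapply Permutation_in; [symmetry; eassumption | assumption].
  - apply in_map_iff in I as (r & <- & Hr); econstructor; eauto.
  - apply in_map_iff in I as (r & <- & Hr); econstructor; eauto.
  - apply in_map_iff in I as (r & <- & Hr); econstructor; eauto.
    intros t Ht; apply in_app_iff in Ht as [Ht | [<- | Ht]].
    + apply A2, in_app_iff; auto.
    + eapply IH; [apply A2, in_app_iff; simpl; auto | assumption].
    + apply A2, in_app_iff; simpl; auto.
Qed.

Lemma approx_pstar s s' M : pstar s s' -> approx s M -> approx s' M.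
Proof.
  induction 1 as [| s s1 s' (T & HT & I) _ IH]; [auto |].
  intro A; apply IH; eapply approx_rstep; eassumption.
Qed.

(** * Normal resource terms *)

Definition normal (s : rterm) : Prop := ~ exists T, rstep s T.

Lemma normal_lam s : normal (RLam s) <-> normal s.
Proof.
  split; intros H (T & HT); apply H.
  - eexists; constructor; eassumption.
  - inversion HT; subst; eexists; eassumption.
Qed.

Lemma normal_app s ts :
  normal (RApp s ts) <->
  (forall s', s <> RLam s') /\ normal s /\ (forall t, In t ts -> normal t).
Proof.
  split.
  - intro H; split; [| split].
    + intros s' ->; apply H; eexists; apply r_beta.
    + intros (T & HT); apply H; eexists; apply r_appl; eassumption.
    + intros t Ht (T & HT); apply H; apply in_split in Ht as (l1 & l2 & ->).
      eexists; apply r_appr; eassumption.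
  - intros (H1 & H2 & H3) (T & HT); inversion HT; subst.
    + eapply H1; reflexivity.
    + apply H2; eauto.
    + eapply H3; [apply in_or_app; right; left; reflexivity | eauto].
Qed.

Lemma normal_var n : normal (RVar n).
Proof. intros (T & HT); inversion HT. Qed.

(** * Decrease of size along resource reduction *)

Fixpoint rsize (s : rterm) : nat :=
  match s with
  | RVar _ => 1
  | RLam s => S (rsize s)
  | RApp s ts => S (rsize s + list_sum (map rsize ts))
  end.

Lemma list_sum_in (l : list nat) n : In n l -> n <= list_sum l.
Proof. induction l; simpl; intros []; subst; [lia | specialize (IHl H); lia]. Qed.

Lemma rsize_bag s ts u : In u ts -> rsize u < rsize (RApp s ts).
Proof.
  intro H; apply (in_map rsize), list_sum_in in H; simpl; lia.
Qed.

Lemma list_sum_perm l l' : Permutation l l' -> list_sum l = list_sum l'.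
Proof. induction 1; simpl; lia. Qed.

Lemma rsize_rlift c d s : rsize (rlift c d s) = rsize s.
Proof.
  revert c; induction s as [| s IH | s ts IH IH'] using rterm_ind_bag; intro c; simpl; auto.
  rewrite IH, map_map; do 3 f_equal; apply map_ext_in; auto.
Qed.

Notation bsize := (fun ts => list_sum (map rsize ts)).

Lemma rsize_lsub s : forall k ts,
  rsize (fst (lsub k ts s)) + bsize (snd (lsub k ts s)) <= rsize s + bsize ts.
Proof.
  induction s as [n | s IH | s us IH IH'] using rterm_ind_bag; intros k ts.
  - simpl; destruct (n =? k); [destruct ts |]; simpl; rewrite ?rsize_rlift; lia.
  - simpl; specialize (IH (S k) ts); destruct (lsub (S k) ts s); simpl in *; lia.
  - assert (Hus : forall ts, bsize (fst (lsubs k ts us)) + bsize (snd (lsubs k ts us))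
                             <= bsize us + bsize ts).
    { clear - IH'; induction us as [| u us IHus]; intros ts; [reflexivity |].
      rewrite lsubs_cons.
      specialize (IH' u (or_introl eq_refl) k ts) as H.
      destruct (lsub k ts u) as [u' ts1].
      specialize (IHus (fun t Ht => IH' t (or_intror Ht)) ts1).
      destruct (lsubs k ts1 us); simpl in *; lia. }
    rewrite lsub_app; specialize (IH k ts); destruct (lsub k ts s) as [s' ts1].
    specialize (Hus ts1); destruct (lsubs k ts1 us); simpl in *; lia.
Qed.

(** A β-step erases an application and an abstraction node and, by linearity, duplicates nothing. *)
Lemma rsize_rstep s T : rstep s T -> forall t, In t T -> rsize t < rsize s.
Proof.
  induction 1 as [s ts | s T H IH | s T us H IH | s us1 u us2 T H IH]; intros t I.
  - apply in_rsubst0 in I as (ts' & Hp & _ & ->).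
    pose proof (rsize_lsub s 0 ts') as L.
    apply (Permutation_map rsize), list_sum_perm in Hp; simpl in *; lia.
  - apply in_map_iff in I as (r & <- & Hr); specialize (IH r Hr); simpl; lia.
  - apply in_map_iff in I as (r & <- & Hr); specialize (IH r Hr); simpl; lia.
  - apply in_map_iff in I as (r & <- & Hr); specialize (IH r Hr); simpl.
    rewrite !map_app, !list_sum_app; simpl; lia.
Qed.

(** * Reduction of finite sums *)

(** The surrounding summands stay put through the alternative [T = [s]] of [sum_step]; the index of
    the active summand moves by [length A]. *)
Lemma sum_step_context A S S' C : sum_step S S' -> sum_step (A ++ S ++ C) (A ++ S' ++ C).
Proof.
  intros (Ts & HF & (i & s & T & H1 & H2 & H3) & ->).
  assert (HK : forall L, Forall2 (fun s T => rstep s T \/ T = [s]) L (map (fun s => [s]) L))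
    by (induction L; simpl; constructor; auto).
  assert (HC : forall L : list rterm, concat (map (fun s => [s]) L) = L)
    by (induction L; simpl; congruence).
  exists (map (fun s => [s]) A ++ Ts ++ map (fun s => [s]) C); split; [| split].
  - repeat apply Forall2_app; auto.
  - exists (length A + i), s, T; split; [| split; [| assumption]].
    + rewrite nth_error_app2, nth_error_app1; [| | lia].
      * replace (length A + i - length A) with i by lia; assumption.
      * replace (length A + i - length A) with i by lia.
        apply nth_error_Some; congruence.
    + rewrite nth_error_app2, nth_error_app1; rewrite ?length_map; [| | lia].
      * replace (length A + i - length A) with i by lia; assumption.
      * replace (length A + i - length A) with i by lia.
        apply nth_error_Some; congruence.
  - rewrite !concat_app, !HC; reflexivity.
Qed.

Lemma sum_red_context A S S' C :
  sum_red_star S S' -> sum_red_star (A ++ S ++ C) (A ++ S' ++ C).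
Proof.
  induction 1; [apply rt_step, sum_step_context | apply rt_refl | eapply rt_trans];
    eassumption.
Qed.

Lemma sum_red_rstep s T : rstep s T -> sum_red_star [s] T.
Proof.
  intro H; apply rt_step; exists [T]; split; [| split].
  - constructor; [auto | constructor].
  - exists 0, s, T; auto.
  - simpl; rewrite app_nil_r; reflexivity.
Qed.

Lemma sum_red_app S S' T T' :
  sum_red_star S S' -> sum_red_star T T' -> sum_red_star (S ++ T) (S' ++ T').
Proof.
  intros H1 H2; eapply rt_trans; [apply (sum_red_context [] _ _ T H1) |].
  pose proof (sum_red_context S' _ _ [] H2) as H; rewrite !app_nil_r in H; exact H.
Qed.

Lemma sum_normal_app S T : sum_normal S -> sum_normal T -> sum_normal (S ++ T).
Proof. intros H1 H2 t Ht; apply in_app_iff in Ht as []; auto. Qed.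

(** Strong induction on size. The last clause lets a chosen normal summand survive while the rest of
    its sum is normalised. *)
Lemma nf_r_exists s : exists T, nf_r s T /\ (normal s -> In s T).
Proof.
  remember (rsize s) as n eqn:E; revert s E.
  induction n as [n IH] using lt_wf_ind; intros s ->.
  destruct (classic (exists T, rstep s T)) as [(T & HT) | HN].
  - assert (Hsum : exists T', sum_red_star T T' /\ sum_normal T').
    { pose proof (rsize_rstep _ _ HT) as HS; clear HT.
      induction T as [| t T IHT].
      - exists []; split; [apply rt_refl | intros t []].
      - destruct IHT as (T1 & R1 & N1); [intros; apply HS; right; assumption |].
        destruct (IH _ (HS t (or_introl eq_refl)) t eq_refl) as (T2 & (R2 & N2) & _).
        exists (T2 ++ T1); split; [| apply sum_normal_app; assumption].
        apply (sum_red_app [t]); assumption. }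
    destruct Hsum as (T' & R & N); exists T'; split.
    + split; [| assumption].
      eapply rt_trans; [apply sum_red_rstep, HT | exact R].
    + intro H; exfalso; apply H; eauto.
  - exists [s]; repeat split; [apply rt_refl | | simpl; auto].
    intros t [<- | []]; exact HN.
Qed.

Lemma sum_nf_exists S :
  exists T, sum_red_star S T /\ sum_normal T /\
            (forall t, In t S -> normal t -> In t T).
Proof.
  induction S as [| s S (T & R & N & I)].
  - exists []; repeat split; [apply rt_refl | intros t [] | intros t []].
  - destruct (nf_r_exists s) as (T' & (R' & N') & I').
    exists (T' ++ T); split; [apply (sum_red_app [s]); assumption |].
    split; [apply sum_normal_app; assumption |].
    intros t [<- | Ht] Hn; apply in_app_iff; auto.
Qed.

(** The other summands produced along the path to [t] are carried as context and normalised at the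
    end. *)
Lemma pstar_nf_r s t : pstar s t -> normal t -> exists T, nf_r s T /\ In t T.
Proof.
  intros H Hn.
  assert (exists S, sum_red_star [s] S /\ In t S) as (S & HS & I).
  { induction H as [s | s s1 t (T & HT & I) _ IH].
    - exists [s]; split; [apply rt_refl | simpl; auto].
    - destruct (IH Hn) as (S & HS & IS).
      apply in_split in I as (A & C & ->).
      exists (A ++ S ++ C); split; [| apply in_app_iff; right; apply in_app_iff; auto].
      eapply rt_trans; [apply sum_red_rstep, HT |].
      apply (sum_red_context A [s1] S C HS). }
  destruct (sum_nf_exists S) as (T & R & N & IT).
  exists T; split; [split; [eapply rt_trans; eassumption | assumption] | auto].
Qed.

Lemma pstar_sum_red S T : sum_red_star S T ->
  forall t, In t T -> exists s, In s S /\ pstar s t.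
Proof.
  intro H; apply clos_rt_rt1n in H.
  induction H as [S | S S1 T (Ts & HF & _ & ->) _ IH]; intros t Ht.
  - exists t; split; [assumption | constructor].
  - destruct (IH t Ht) as (s1 & I & R); clear - HF I R.
    induction HF as [| s T0 S Ts H HF IH]; [contradiction |].
    simpl in I; apply in_app_iff in I as [I | I].
    + exists s; split; [simpl; auto |].
      destruct H as [H | ->].
      * econstructor; [exists T0; split; eassumption | exact R].
      * destruct I as [<- | []]; exact R.
    + destruct (IH I) as (s' & ? & ?); exists s'; simpl; auto.
Qed.

(** * Head reduction and Boehm trees *)

Lemma apps_snoc M Ns N : apps M (Ns ++ [N]) = App (apps M Ns) N.
Proof. revert M; induction Ns; simpl; auto. Qed.

Lemma wstep_apps M M' Ns : wstep M M' -> wstep (apps M Ns) (apps M' Ns).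
Proof. revert M M'; induction Ns; simpl; intros; [| apply IHNs; constructor]; assumption. Qed.

(** Trades the argument list of [h_redex] for structural rules, on which inversion works. *)
Lemma hstep_wstep M M' :
  hstep M M' <->
  wstep M M' \/ exists N N', M = Lam N /\ M' = Lam N' /\ hstep N N'.
Proof.
  split.
  - destruct 1 as [N P Qs | M M' H]; [left; apply wstep_apps; constructor | right; eauto].
  - intros [H | (N & N' & -> & -> & H)]; [| constructor; assumption].
    cut (exists N P Qs, M = apps (App (Lam N) P) Qs /\ M' = apps (subst0 P N) Qs).
    { intros (N & P & Qs & -> & ->); constructor. }
    induction H as [N P | M M' Q H (N & P & Qs & -> & ->)].
    + exists N, P, []; auto.
    + exists N, P, (Qs ++ [Q]); rewrite !apps_snoc; auto.
Qed.

Lemma wstep_det M N P : wstep M N -> wstep M P -> N = P.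
Proof.
  intro H; revert P; induction H as [| M M1 Q H IH]; intros Z H1; inversion H1; subst.
  - reflexivity.
  - match goal with H : wstep (Lam _) _ |- _ => inversion H end.
  - inversion H.
  - f_equal; auto.
Qed.

Lemma hstep_det M N : hstep M N -> forall P, hstep M P -> N = P.
Proof.
  induction 1 as [N P Qs | M M' H IH]; intros Z HZ.
  - apply hstep_wstep in HZ as [HZ | (? & ? & E & _)].
    + eapply wstep_det; [| eassumption]; apply wstep_apps; constructor.
    (* A term with a weak head redex cannot be an abstraction. *)
    + pose proof (wstep_apps _ _ Qs (w_beta N P)) as W; rewrite E in W; inversion W.
  - apply hstep_wstep in HZ as [HZ | (N & N' & E & -> & HZ)]; [inversion HZ |].
    injection E as ->; f_equal; auto.
Qed.

Lemma wstep_hnf y Ms N : ~ wstep (apps (Var y) Ms) N.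
Proof.
  revert N; induction Ms as [| P Ms IH] using rev_ind; intros N H.
  - inversion H.
  - rewrite apps_snoc in H; inversion H; subst; [| eapply IH; eassumption].
    destruct Ms as [| Q Ms] using rev_ind; [| rewrite apps_snoc in *]; discriminate.
Qed.

Lemma apps_var_not_lam y Ms N : apps (Var y) Ms <> Lam N.
Proof. destruct Ms using rev_ind; rewrite ?apps_snoc; discriminate. Qed.

Lemma hstep_hnf m y Ms N : ~ hstep (lams m (apps (Var y) Ms)) N.
Proof.
  revert N; induction m as [| m IH]; simpl; intros N H;
    apply hstep_wstep in H as [H | (P & P' & E & _ & H)].
  - eapply wstep_hnf; eassumption.
  - eapply apps_var_not_lam; eassumption.
  - inversion H.
  - injection E as <-; eapply IH; eassumption.
Qed.

Lemma hstar_hnf_unique M N m y Ms :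
  hstar M N -> hstar M (lams m (apps (Var y) Ms)) ->
  (forall P, ~ hstep N P) -> N = lams m (apps (Var y) Ms).
Proof.
  intros H1 H2 HN; apply clos_rt_rt1n in H1, H2.
  revert N H1 HN; remember (lams m (apps (Var y) Ms)) as Z eqn:E; revert E.
  induction H2 as [Z | M M1 Z H H2 IH]; intros E N H1 HN.
  - destruct H1 as [| M1 N H1 _]; [reflexivity |].
    subst; destruct (hstep_hnf _ _ _ _ H1).
  - destruct H1 as [| M2 N H1 H3]; [destruct (HN _ H) |].
    rewrite (hstep_det _ _ H1 _ H) in H3; auto.
Qed.

Lemma apps_var_inj y y' Ms Ms' :
  apps (Var y) Ms = apps (Var y') Ms' -> y = y' /\ Ms = Ms'.
Proof.
  revert Ms'; induction Ms as [| M Ms IH] using rev_ind; intros Ms' E;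
    destruct Ms' as [| M' Ms' _] using rev_ind; rewrite ?apps_snoc in E;
    try discriminate; injection E as E; subst; auto.
  destruct (IH _ E) as [-> ->]; auto.
Qed.

Lemma hnf_inj m y Ms m' y' Ms' :
  lams m (apps (Var y) Ms) = lams m' (apps (Var y') Ms') ->
  m = m' /\ y = y' /\ Ms = Ms'.
Proof.
  revert m'; induction m as [| m IH]; intros [| m'] E; simpl in E.
  - split; [reflexivity | apply apps_var_inj, E].
  - destruct (apps_var_not_lam _ _ _ E).
  - destruct (apps_var_not_lam _ _ _ (eq_sym E)).
  - injection E as E; destruct (IH _ E) as (-> & ?); auto.
Qed.

Lemma hstar_lam M N : hstar M N -> hstar (Lam M) (Lam N).
Proof.
  induction 1; [apply rt_step; constructor | apply rt_refl | eapply rt_trans]; eassumption.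
Qed.

Lemma wstar_hstar M N : wstar M N -> hstar M N.
Proof.
  induction 1; [apply rt_refl |].
  eapply rt_trans; [apply rt_step, hstep_wstep; left |]; eassumption.
Qed.

(** * Unfolding and existence of Böhm trees *)

Lemma BT_unfold M B : BT M B -> BT_step BT M B.
Proof.
  intros (R & HR & H).
  assert (HM : forall Ms Bs, Forall2 R Ms Bs -> Forall2 BT Ms Bs)
    by (induction 1; constructor; [exists R |]; auto).
  destruct (HR _ _ H); [apply BTs_bot | eapply BTs_hnf]; eauto.
Qed.

(* The part of a Boehm tree still to be unfolded; the arguments of the head variable
   are reversed, so that the first one belongs to the outermost application. *)
Inductive state : Type :=
| SBot : state
| SHnf (m y : nat) (rMs : list term) : state.

Definition is_state (M : term) (st : state) : Prop :=
  match st with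
  | SBot => ~ (solvable M /\ exists m y Ms, hstar M (lams m (apps (Var y) Ms)))
  | SHnf m y rMs => solvable M /\ hstar M (lams m (apps (Var y) (rev rMs)))
  end.

Lemma is_state_exists M : exists st, is_state M st.
Proof.
  destruct (classic (solvable M /\ exists m y Ms, hstar M (lams m (apps (Var y) Ms))))
    as [(HS & m & y & Ms & H) | H].
  - exists (SHnf m y (rev Ms)); simpl; rewrite rev_involutive; auto.
  - exists SBot; exact H.
Qed.

(** Having a head normal form is undecidable, so the state is picked by indefinite description. *)
Definition analyse (M : term) : state :=
  proj1_sig (constructive_indefinite_description _ (is_state_exists M)).

(** Emits one constructor per call: returning a whole head normal form would hide the corecursive
    calls beneath [lams] and [apps], against guardedness. *)
CoFixpoint build (st : state) : term :=
  match st with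
  | SBot => Bot
  | SHnf (S m) y rMs => Lam (build (SHnf m y rMs))
  | SHnf 0 y [] => Var y
  | SHnf 0 y (N :: rMs) => App (build (SHnf 0 y rMs)) (build (analyse N))
  end.

Lemma build_hnf m y rMs :
  build (SHnf m y rMs) =
  lams m (apps (Var y) (map (fun N => build (analyse N)) (rev rMs))).
Proof.
  induction m as [| m IH].
  - induction rMs as [| N rMs IH]; rewrite (term_eta (build _)); [reflexivity |].
    simpl in *; rewrite map_app; simpl; rewrite apps_snoc, <- IH; reflexivity.
  - rewrite (term_eta (build _)); simpl; rewrite IH; reflexivity.
Qed.

Lemma BT_exists M : exists B, BT M B.
Proof.
  exists (build (analyse M)), (fun M B => B = build (analyse M)); split; [| reflexivity].
  clear M; intros M B ->; unfold analyse at 2.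
  destruct (constructive_indefinite_description _ (is_state_exists M)) as [st H]; simpl.
  destruct st as [| m y rMs].
  - rewrite (term_eta (build SBot)); constructor; exact H.
  - rewrite build_hnf; destruct H as [HS H]; eapply BTs_hnf; [exact HS | exact H |]; clear.
    induction (rev rMs); simpl; constructor; auto.
Qed.

(** * Head normal forms are solvable *)

Lemma bstar_apps M M' Ns : bstar M M' -> bstar (apps M Ns) (apps M' Ns).
Proof.
  intro H; induction Ns as [| N Ns IH] using rev_ind; [exact H |].
  rewrite !apps_snoc; clear H; induction IH;
    [apply rt_step; constructor | apply rt_refl | eapply rt_trans]; eassumption.
Qed.

Lemma bstar_lams m M M' : bstar M M' -> bstar (lams m M) (lams m M').
Proof.
  intro H; induction m as [| m IH]; [exact H |].
  simpl; clear H; induction IH;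
    [apply rt_step; constructor | apply rt_refl | eapply rt_trans]; eassumption.
Qed.

Lemma hstar_bstar M N : hstar M N -> bstar M N.
Proof.
  induction 1 as [M N H | |]; [| apply rt_refl | eapply rt_trans; eassumption].
  apply rt_step; induction H as [N P Qs |]; [| constructor; assumption].
  induction Qs as [| Q Qs IH] using rev_ind; [constructor |].
  rewrite !apps_snoc; constructor; exact IH.
Qed.

Lemma subst_lams s m M : subst s (lams m M) = lams m (subst (upn m s) M).
Proof.
  revert s; induction m as [| m IH]; intro s; [reflexivity |].
  simpl; rewrite subst_lam, IH; do 3 f_equal.
  clear; induction m as [| m IH]; [reflexivity | simpl; rewrite IH; reflexivity].
Qed.

Lemma subst_apps s M Ms : subst s (apps M Ms) = apps (subst s M) (map (subst s) Ms).
Proof.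
  revert M; induction Ms as [| N Ms IH]; intro M; [reflexivity |].
  simpl; rewrite IH, subst_app; reflexivity.
Qed.

Definition eraser (n : nat) : term := lams n (Lam (Var 0)).

Lemma subst_eraser s n : subst s (eraser n) = eraser n.
Proof. unfold eraser; rewrite subst_lams, subst_lam, subst_var; reflexivity. Qed.

Lemma ren_eraser f n : ren f (eraser n) = eraser n.
Proof.
  revert f; induction n as [| n IH]; intro f; unfold eraser in *; simpl;
    rewrite ren_lam; [rewrite ren_var; reflexivity | rewrite IH; reflexivity].
Qed.

Lemma rens_eraser k n : Nat.iter k (ren S) (eraser n) = eraser n.
Proof. induction k as [| k IH]; simpl; [| rewrite IH, ren_eraser]; reflexivity. Qed.

Lemma bstar_beta_apps N P Ns M :
  bstar (apps (subst0 P N) Ns) M -> bstar (apps (Lam N) (P :: Ns)) M.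
Proof.
  intro H; eapply rt_trans; [| exact H].
  simpl; apply bstar_apps, rt_step; constructor.
Qed.

Lemma eraser_apps Ms : bstar (apps (eraser (length Ms)) Ms) (Lam (Var 0)).
Proof.
  induction Ms as [| M Ms IH]; [apply rt_refl |].
  apply (bstar_beta_apps (eraser (length Ms)) M Ms); unfold subst0.
  rewrite subst_eraser; exact IH.
Qed.

(** The disjunction on the head [H] is the invariant: binders are contracted from the outside, and
    the head variable becomes the eraser when its own binder is reached. Substitution alters the
    arguments but preserves their number, which is all the eraser depends on. *)
Lemma lams_erasers k n H Ms :
  (exists y, y < k /\ H = Var y) \/ H = eraser n ->
  exists Ms', length Ms' = length Ms /\
    bstar (apps (lams k (apps H Ms)) (repeat (eraser n) k)) (apps (eraser n) Ms').
Proof.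
  revert H Ms; induction k as [| k IH]; intros H Ms HH.
  - exists Ms; split; [reflexivity |].
    destruct HH as [(y & ? & _) | ->]; [lia | apply rt_refl].
  - set (s := upn k (scons (eraser n))).
    destruct (IH (subst s H) (map (subst s) Ms)) as (Ms' & HL & HB).
    + destruct HH as [(y & Hy & ->) | ->]; [| right; apply subst_eraser].
      unfold s; rewrite subst_var, upn_scons.
      destruct (Nat.eqb_spec y k); [right; apply rens_eraser | left].
      eexists; split; [| reflexivity]; destruct (Nat.ltb_spec k y); lia.
    + exists Ms'; split; [rewrite HL; apply length_map |].
      apply bstar_beta_apps; unfold subst0; rewrite subst_lams, subst_apps; exact HB.
Qed.

Lemma in001_eraser n : in001 (eraser n).
Proof.
  exists (fun M => exists n, M = eraser n); split; [| eauto].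
  intros N (k & ->); unfold eraser; induction k; simpl; repeat constructor; assumption.
Qed.

Lemma lams_add j k M : lams j (lams k M) = lams (j + k) M.
Proof. induction j; simpl; congruence. Qed.

Lemma hnf_solvable M m y Ms : hstar M (lams m (apps (Var y) Ms)) -> solvable M.
Proof.
  intro H; set (n := length Ms).
  (* Abstracting [S y] further variables binds the head variable even when it is free, as
     [y < S y + m]; each binder then receives an eraser whose arity is the number of head
     arguments. *)
  exists (S y), (repeat (eraser n) (S y + m)); split.
  - apply Forall_forall; intros N HN; apply repeat_spec in HN; subst.
    apply in001_eraser.
  - exists (fun M N => bstar M (Lam (Var 0)) /\ N = Lam (Var 0)); split.
    + intros M0 N0 [H0 ->].
      eapply bi_lam; [eassumption | apply bi_var, rt_refl].
    + split; [| reflexivity].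
      eapply rt_trans; [apply bstar_apps, bstar_lams, hstar_bstar, H |].
      rewrite lams_add.
      destruct (lams_erasers (S y + m) n (Var y) Ms) as (Ms' & HL & HB).
      { left; exists y; split; [lia | reflexivity]. }
      eapply rt_trans; [exact HB |].
      unfold n; rewrite <- HL; apply eraser_apps.
Qed.

(** * Normal approximants are approximants of the Boehm tree *)

(** The induction hypothesis of [approx_BT], isolated so that it can be assumed for all arguments of
    a head normal form through [Forall2]. *)
Definition Below (n : nat) (N B : term) : Prop :=
  forall u, rsize u < n -> normal u -> approx u N -> ltimes u B.

Lemma Below_le n n' Ms Bs :
  n <= n' -> Forall2 (Below n') Ms Bs -> Forall2 (Below n) Ms Bs.
Proof.
  intros L H; induction H; constructor; [| assumption].
  intros u Hu; apply H; lia.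
Qed.

(** Normality keeps abstractions out of function position, so the weak head reductions along the
    spine compose and end at a variable. Bag elements are smaller than [s], hence within reach of
    [Below (rsize s)]. *)
Lemma normal_neutral_approx s M :
  approx s M -> normal s -> (forall s', s <> RLam s') ->
  exists y Ms, wstar M (apps (Var y) Ms) /\
    forall Bs, Forall2 (Below (rsize s)) Ms Bs -> ltimes s (apps (Var y) Bs).
Proof.
  induction 1 as [n M H | s M P H A IH | s ts M P Q H A IH A' _]; intros Hn Hl.
  - exists n, []; split; [exact H |].
    intros Bs HB; inversion HB; constructor.
  - destruct (Hl s eq_refl).
  - apply normal_app in Hn as (Hl' & Hs & Hts).
    destruct (IH Hs Hl') as (y & Ms & HM & HB).
    exists y, (Ms ++ [Q]); rewrite apps_snoc; split.
    + eapply wstar_trans; [exact H | apply wstar_app, HM].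
    + intros Bs F; apply Forall2_app_inv_l in F as (Bs1 & Bs2 & F1 & F2 & ->).
      inversion F2 as [| ? B ? ? FB F3]; inversion F3; subst.
      rewrite apps_snoc; constructor.
      * apply HB; eapply Below_le; [| exact F1]; simpl; lia.
      * apply Forall_forall; intros t Ht; apply FB; auto using rsize_bag.
Qed.

Lemma normal_approx s M :
  approx s M -> normal s ->
  exists m y Ms, hstar M (lams m (apps (Var y) Ms)) /\
    forall Bs, Forall2 (Below (rsize s)) Ms Bs -> ltimes s (lams m (apps (Var y) Bs)).
Proof.
  intros A Hn; revert M A; induction s as [n | s IH | s _ ts]; intros M A.
  2: {
    apply (normal_lam s) in Hn; inversion A as [| ? ? P HM A' |]; subst.
    destruct (IH Hn _ A') as (m & y & Ms & HP & HB).
    exists (S m), y, Ms; split.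
    - eapply rt_trans; [apply wstar_hstar, HM | apply hstar_lam, HP].
    - intros Bs F; constructor; apply HB; eapply Below_le; [| exact F]; simpl; lia. }
  all: destruct (normal_neutral_approx _ _ A Hn) as (y & Ms & HM & HB); [discriminate |];
    exists 0, y, Ms; split; [apply wstar_hstar, HM | exact HB].
Qed.

(** A normal approximant yields a head normal form of [M], which rules out ⊥ by [hnf_solvable];
    uniqueness identifies it with the one recorded by [BT]. *)
Lemma approx_BT n M B : BT M B -> Below n M B.
Proof.
  revert M B; induction n as [n IH] using lt_wf_ind; intros M B HB u Hu Hn A.
  destruct (normal_approx _ _ A Hn) as (m & y & Ms & HM & HL).
  destruct (BT_unfold _ _ HB) as [M HN | M m' y' Ms' Bs _ HM' F].
  - destruct HN; split; [eapply hnf_solvable, HM | eauto].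
  - apply (hstar_hnf_unique _ _ _ _ _ HM) in HM'; [| apply hstep_hnf].
    apply hnf_inj in HM' as (-> & -> & ->).
    apply HL; clear - F IH Hu; induction F; constructor; auto.
Qed.

(** The condition on a bag concerns its elements one by one, hence is invariant under
    permutation. *)
Lemma ltimes_req t t' M : req t t' -> ltimes t' M -> ltimes t M.
Proof.
  revert t' M; induction t as [n | s IH | s ts IH IH'] using rterm_ind_bag;
    intros t' M E L; inversion E as [| ? s' E1 | ? s' ? us' vs E1 HP HF]; subst;
    inversion L as [| ? ? L1 | ? ? ? Q L1 LF]; subst; constructor; eauto.
  rewrite HP in LF; clear - HF LF IH'.
  induction HF as [| t v ts vs E HF IH]; constructor; inversion LF; subst.
  - eapply IH'; [left; reflexivity | eassumption | assumption].
  - apply IH; [intros; eapply IH'; [right |..]; eassumption | assumption].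
Qed.

Lemma req_refl t : req t t.
Proof.
  induction t as [n | s IH | s ts IH IH'] using rterm_ind_bag; econstructor; eauto.
  clear - IH'; induction ts; constructor; [| apply IHts; intros]; apply IH'; simpl; auto.
Qed.

(** * Approximants of the Boehm tree are normal forms of approximants *)

(** Induction is on the finite approximant [s], since [M] may be infinite; the shape of [M] is then
    forced by that of [s]. *)
Lemma ltimes_rlift c s M :
  ltimes s (subst (upn c (fun n => Var (S n))) M) ->
  exists t, s = rlift c 1 t /\ ltimes t M.
Proof.
  revert c M; induction s as [n | s IH | s ts IH IH'] using rterm_ind_bag;
    intros c M L; destruct M as [x | | P | P Q]; revert L; push; rewrite ?upn_shift;
    intro L; inversion L as [| | ? ? ? ? L1 LF]; subst.
  - exists (RVar x); split; [reflexivity | constructor].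
  - destruct (IH (S c) P) as (t & -> & Ht); [assumption |].
    exists (RLam t); split; [reflexivity | constructor; assumption].
  - destruct (IH c P) as (t & -> & Ht); [assumption |].
    assert (exists us, ts = map (rlift c 1) us /\ Forall (fun t => ltimes t Q) us)
      as (us & -> & Hus).
    { clear - IH' LF; induction LF as [| u ts Hu HF IHF].
      - exists []; auto.
      - destruct (IH' u (or_introl eq_refl) c Q Hu) as (v & -> & Hv).
        destruct IHF as (vs & -> & Hvs); [intros; apply IH'; simpl; auto |].
        exists (v :: vs); auto. }
    exists (RApp t us); split; [reflexivity | constructor; assumption].
Qed.

Lemma ltimes_bisim s M N : bisim M N -> ltimes s M -> ltimes s N.
Proof.
  revert M N; induction s as [n | s IH | s ts IH IH'] using rterm_ind_bag;
    intros M N B L; inversion L; subst; inversion B; subst; constructor; eauto.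
  rewrite Forall_forall in *; eauto.
Qed.

Lemma ltimes_rens k s P :
  ltimes s (Nat.iter k (ren S) P) -> exists t, s = rlift 0 k t /\ ltimes t P.
Proof.
  revert s; induction k as [| k IH]; simpl; intros s L.
  - exists s; rewrite rlift_0; auto.
  - eapply ltimes_bisim in L; [| apply ren_as_subst; reflexivity].
    apply (ltimes_rlift 0) in L as (t & -> & L).
    destruct (IH _ L) as (u & -> & Lu).
    exists u; rewrite rlift_rlift; auto.
Qed.

(** Converse of [lsub_approx]: the pieces of [s] lying over the substituted variable are collected,
    from left to right, into [ts]. The surplus [rest] makes successive calls composable, since what
    one subterm leaves over feeds the next. *)
Lemma ltimes_lsub P s N : forall k,
  ltimes s (subst (upn k (scons P)) N) ->
  exists r ts, ltimes r N /\ Forall (fun t => ltimes t P) ts /\ occ k r = length ts /\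
    forall rest, lsub k (ts ++ rest) r = (s, rest).
Proof.
  revert N; induction s as [n | s IH | s us IH IH'] using rterm_ind_bag; intros N k L.
  all: destruct N as [x | | N | N Q]; revert L; push.
  all: try solve [intro L; inversion L].
  (* If [N] is the substituted variable, [s] may have any shape and is, up to lifting, the only
     element of [ts]. *)
  all: try (rewrite upn_scons; intro L; exists (RVar x); simpl;
    destruct (Nat.eqb_spec x k);
    [ apply ltimes_rens in L as (t & -> & L); exists [t]; repeat constructor; assumption
    | inversion L; subst; exists []; repeat constructor ]).
  - intro L; inversion L; subst.
    destruct (IH N (S k)) as (r & ts & Hr & Hts & Ho & HL); [assumption |].
    exists (RLam r), ts; repeat split; [constructor; assumption | assumption | exact Ho |].
    intro rest; simpl; rewrite HL; reflexivity.
  - intro L; inversion L as [| | ? ? ? ? L1 LF]; subst.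
    destruct (IH N k) as (r & ts & Hr & Hts & Ho & HL); [assumption |].
    assert (exists vs ts, Forall (fun t => ltimes t Q) vs /\
              Forall (fun t => ltimes t P) ts /\
              list_sum (map (occ k) vs) = length ts /\
              forall rest, lsubs k (ts ++ rest) vs = (us, rest))
      as (vs & ts' & Hvs & Hts' & Ho' & HL').
    { clear - IH' LF; induction LF as [| u us Hu HF IHF].
      - exists [], []; auto.
      - destruct (IH' u (or_introl eq_refl) Q k Hu) as (v & ts1 & ? & ? & O1 & E1).
        destruct IHF as (vs & ts2 & ? & ? & O2 & E2); [intros; apply IH'; simpl; auto |].
        exists (v :: vs), (ts1 ++ ts2); repeat split; auto.
        + apply Forall_app; auto.
        + simpl; rewrite length_app; lia.
        + intro rest; rewrite lsubs_cons, <- app_assoc, E1, E2; reflexivity. }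
    exists (RApp r vs), (ts ++ ts'); repeat split.
    + constructor; assumption.
    + apply Forall_app; auto.
    + simpl; rewrite length_app; lia.
    + intro rest; rewrite lsub_app, <- app_assoc, HL, HL'; reflexivity.
Qed.

(** The function position of an application is approximated by exactly one resource term, so a weak
    head step is mirrored by a single resource step. *)
Lemma ltimes_wstep_expand M M' s :
  wstep M M' -> ltimes s M' -> exists r, ltimes r M /\ pstep r s.
Proof.
  intro H; revert s; induction H as [N P | M M' N H IH]; intros s L.
  - rewrite subst0_upn in L; apply ltimes_lsub in L as (r & ts & Hr & Hts & Ho & HL).
    exists (RApp (RLam r) ts); split; [repeat constructor; assumption |].
    exists (rsubst0 r ts); split; [constructor |].
    unfold rsubst0; rewrite Ho, Nat.eqb_refl; apply in_map_iff.
    (* The bag was built in the order in which [lsub] consumes it, so the identity permutation gives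
       the summand [s]. *)
    exists ts; split; [| apply perms_self].
    specialize (HL []); rewrite app_nil_r in HL; rewrite HL; reflexivity.
  - inversion L as [| | s' ts ? ? L1 L2]; subst.
    destruct (IH _ L1) as (r & Hr & T & HT & I).
    exists (RApp r ts); split; [constructor; assumption |].
    eexists; split; [constructor; eassumption | apply (in_map (fun t => RApp t ts)), I].
Qed.

Lemma ltimes_hstep_expand M M' s :
  hstep M M' -> ltimes s M' -> exists r, ltimes r M /\ pstep r s.
Proof.
  intro H; revert s; induction H as [N P Qs | M M' H IH]; intros s L.
  - eapply ltimes_wstep_expand; [| exact L]; apply wstep_apps; constructor.
  - inversion L as [| s' ? L1 |]; subst.
    destruct (IH _ L1) as (r & Hr & T & HT & I).
    exists (RLam r); split; [constructor; assumption |].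
    eexists; split; [constructor; eassumption | apply in_map, I].
Qed.

Lemma ltimes_hstar_expand M M' s :
  hstar M M' -> ltimes s M' -> exists r, ltimes r M /\ pstar r s.
Proof.
  intro H; apply clos_rt_rt1n in H; revert s; induction H as [| M M1 M' H _ IH]; intros s L.
  - exists s; split; [assumption | constructor].
  - destruct (IH _ L) as (r1 & L1 & R1).
    destruct (ltimes_hstep_expand _ _ _ H L1) as (r & Lr & R).
    exists r; split; [assumption | econstructor; eassumption].
Qed.

Lemma pstar_trans s t u : pstar s t -> pstar t u -> pstar s u.
Proof. induction 1; [auto | econstructor; eauto]. Qed.

Lemma pstar_lam s s' : pstar s s' -> pstar (RLam s) (RLam s').
Proof.
  induction 1 as [| s s1 s' (T & HT & I) _ IH]; econstructor; [| exact IH].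
  eexists; split; [constructor; eassumption | apply in_map, I].
Qed.

Lemma pstar_appl s s' ts : pstar s s' -> pstar (RApp s ts) (RApp s' ts).
Proof.
  induction 1 as [| s s1 s' (T & HT & I) _ IH]; econstructor; [| exact IH].
  eexists; split; [constructor; eassumption | apply (in_map (fun t => RApp t ts)), I].
Qed.

Lemma pstar_appr s us ts ts' :
  Forall2 pstar ts ts' -> pstar (RApp s (us ++ ts)) (RApp s (us ++ ts')).
Proof.
  intro F; revert us; induction F as [| t t' ts ts' H F IH]; intro us; [constructor |].
  apply pstar_trans with (RApp s (us ++ t' :: ts)).
  - clear F IH; induction H as [| t t1 t' (T & HT & I) _ IH]; econstructor; [| exact IH].
    eexists; split; [constructor; eassumption |].
    apply (in_map (fun t => RApp s (us ++ t :: ts))), I.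
  - specialize (IH (us ++ [t'])); rewrite <- !app_assoc in IH; exact IH.
Qed.

(** Each element of a bag of [t] has its own ancestor approximating the corresponding argument;
    these ancestors together form the bag of the ancestor of [t]. *)
Lemma ltimes_hnf_expand t m y Ms Bs :
  Forall2 (fun N B => forall u, rsize u < rsize t -> ltimes u B ->
             normal u /\ exists s, ltimes s N /\ pstar s u) Ms Bs ->
  ltimes t (lams m (apps (Var y) Bs)) ->
  normal t /\ exists s, ltimes s (lams m (apps (Var y) Ms)) /\ pstar s t.
Proof.
  revert t; induction m as [| m IHm]; simpl; intros t F L.
  (* Along the spine, not being an abstraction is carried in the induction, since normality of the
     next application depends on it. *)
  - enough (normal t /\ (forall t', t <> RLam t') /\
            exists s, ltimes s (apps (Var y) Ms) /\ pstar s t) by tauto.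
    revert t Bs F L; induction Ms as [| N Ms IH] using rev_ind; intros t Bs F L.
    + inversion F; subst; inversion L; subst.
      split; [apply normal_var | split; [discriminate |]].
      exists (RVar y); split; constructor.
    + apply Forall2_app_inv_l in F as (Bs1 & Bs2 & F1 & F2 & ->).
      inversion F2 as [| ? B ? ? FB F3]; inversion F3; subst.
      rewrite apps_snoc in *; inversion L as [| | t0 ts ? ? L0 Lts]; subst.
      destruct (IH t0 Bs1) as (Hn & Hl & s0 & Hs0 & R0); [| assumption |].
      { clear - F1; induction F1 as [| ? ? ? ? H]; constructor; [| assumption].
        intros u Hu; apply H; simpl; lia. }
      rewrite Forall_forall in Lts.
      split; [| split; [discriminate |]].
      * apply normal_app; split; [exact Hl | split; [exact Hn |]].
        intros u Hu; apply FB; auto using rsize_bag.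
      * assert (exists ss, Forall (fun s => ltimes s N) ss /\ Forall2 pstar ss ts)
          as (ss & Hss & Rss).
        { assert (G : forall u, In u ts -> exists s, ltimes s N /\ pstar s u)
            by (intros u Hu; apply FB; auto using rsize_bag).
          clear - G; induction ts as [| u ts IH]; [exists []; auto |].
          destruct (G u (or_introl eq_refl)) as (s & ? & ?).
          destruct IH as (ss & ? & ?); [intros; apply G; simpl; auto |].
          exists (s :: ss); auto. }
        exists (RApp s0 ss); split; [constructor; assumption |].
        eapply pstar_trans; [apply pstar_appl, R0 | apply (pstar_appr t0 []), Rss].
  - inversion L as [| t0 ? L0 |]; subst.
    destruct (IHm t0) as (Hn & s & Hs & R); [| assumption |].
    { clear - F; induction F as [| ? ? ? ? H]; constructor; [| assumption].
      intros u Hu; apply H; simpl; lia. }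
    split; [apply normal_lam, Hn |].
    exists (RLam s); split; [constructor; assumption | apply pstar_lam, R].
Qed.

(** Having an approximant excludes [B = Bot]; the ancestor found over the head normal form is then
    pulled back along the head reduction of [M]. *)
Lemma ltimes_BT n M B : BT M B -> forall t, rsize t < n -> ltimes t B ->
  normal t /\ exists s, ltimes s M /\ pstar s t.
Proof.
  revert M B; induction n as [n IH] using lt_wf_ind; intros M B HB t Ht L.
  destruct (BT_unfold _ _ HB) as [| M m y Ms Bs HS HM F]; [inversion L |].
  destruct (ltimes_hnf_expand t m y Ms Bs) as (Hn & s & Hs & R); [| exact L |].
  - clear - F IH Ht; induction F as [| N C Ms Bs H F IHF]; constructor; [| assumption].
    intros u Hu; exact (IH _ Ht N C H u Hu).
  - split; [exact Hn |].
    destruct (ltimes_hstar_expand _ _ _ HM Hs) as (r & Hr & Rr).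
    exists r; split; [exact Hr | eapply pstar_trans; eassumption].
Qed.

Theorem mainTheorem15 (M : term) :
  in001 M ->
  (exists B, BT M B) /\
  (forall B, BT M B -> forall t, NF_r (Taylor M) t <-> Taylor B t).
Proof.
  intros _; split; [apply BT_exists |].
  intros B HB t; split.
  - intros (s & Hs & T & (HR & HN) & t' & I & E).
    (* The initial sum is the singleton [[s]], so the ancestor of [t'] can only be [s]. *)
    destruct (pstar_sum_red _ _ HR _ I) as (s0 & [<- | []] & R).
    apply (ltimes_req _ _ _ E); apply (approx_BT (S (rsize t')) M B HB); [lia | |].
    + apply HN, I.
    + eapply approx_pstar; [exact R | apply approx_ltimes, Hs].
  - intro L; destruct (ltimes_BT (S (rsize t)) M B HB t) as (Hn & s & Hs & R);
      [lia | exact L |].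
    destruct (pstar_nf_r _ _ R Hn) as (T & HT & I).
    exists s; split; [exact Hs |].
    exists T; split; [exact HT | exists t; split; [exact I | apply req_refl]].
Qed.
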